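(* If the update cost satisfies $c\geq 0$, then there exists a threshold-type policy of the MDP $\Omega$ that is $\Omega$-optimal.
   Context: MDP $\Omega$ (with arrival probability $p$ and update cost $c$). The state in slot $t=0,1,\dots$ is $\mathbf{S}(t)=(X(t),\Lambda(t))$ with age $X(t)\in\{1,2,\dots\}$ and arrival indicator $\Lambda(t)\in\{0,1\}$, the $\Lambda(t)$ being i.i.d. with $P[\Lambda(t)=1]=p$. The action is $A(t)\in\{0,1\}$ ($1$: update, $0$: idle). The next age is $X(t+1)=1$ if $A(t)=1$ and $\Lambda(t)=1$, and $X(t+1)=X(t)+1$ otherwise. The immediate cost is $C((x,\lambda),a)=(x+1-x a\lambda)+c\,a$. A policy $\mu$ chooses $A(t)$ for each slot, possibly at random and depending on the history of states up to slot $t$ and actions up to slot $t-1$; its average cost is $J(\mu)=\limsup_{T\to\infty}\frac1{T+1}E_\mu\left[\sum_{t=0}^T C(\mathbf{S}(t),A(t))\right]$. A policy is $\Omega$-optimal if it minimizes $J(\mu)$ over all policies. Threshold-type policy: a deterministic stationary policy (the action is a fixed function of the current state) for which there is a threshold $\bar X\in\{1,2,\dots\}$ such that the action is to update in state $(x,1)$ with $x\geq\bar X$, and to idle in every other state (in particular in all states $(x,0)$). *)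

(* Defs.v *)
From HB Require Import structures.
From mathcomp Require Import all_boot all_order all_algebra.
From mathcomp Require Import all_classical all_reals all_analysis.

Set Implicit Arguments.
Unset Strict Implicit.
Unset Printing Implicit Defensive.

Import Order.TTheory GRing.Theory Num.Theory.

Local Open Scope ring_scope.

(* (age, arrival indicator).  Ages are positive: this holds along every
   trajectory that starts from a positive age, and the age 0 is never used. *)
Definition state := (nat * bool)%type.

Definition next_age (s : state) (a : bool) : nat :=
  if a && s.2 then 1%N else s.1.+1.

Definition cost (R : realType) (c : R) (s : state) (a : bool) : R :=
  (s.1%:R + 1 - s.1%:R * a%:R * s.2%:R) + c * a%:R.

(* [update_prob mu h s] is the conditional probability of A(t) = 1 given
   S(t) = s and h = [:: (S(0), A(0)); ...; (S(t-1), A(t-1))]; the slot t is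
   recovered as [size h], so that nonstationary policies are included. *)
Record policy (R : realType) := Policy {
  update_prob :> seq (state * bool) -> state -> R;
  update_prob01 : forall h s, 0 <= update_prob h s <= 1 }.

Definition deterministic_stationary (R : realType) (mu : policy R)
    (f : state -> bool) : Prop :=
  forall h s, mu h s = (f s)%:R.

Definition threshold_type (R : realType) (mu : policy R) : Prop :=
  exists f : state -> bool, deterministic_stationary mu f /\
  exists Xbar : nat, (0 < Xbar)%N /\
    forall x l, f (x, l) = l && (Xbar <= x)%N.

(* Given the initial age x, finitely many slots are described by the word w of
   the pairs (Lambda(t), A(t)), which determines all states. *)
Fixpoint trajectory (x : nat) (w : seq (bool * bool)) : seq (state * bool) :=
  if w is (l, a) :: w' then ((x, l), a) :: trajectory (next_age (x, l) a) w'
  else [::].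

(* Probability of w when the current age is x and h is the past. *)
Fixpoint word_prob (R : realType) (p : R) (mu : policy R)
    (h : seq (state * bool)) (x : nat) (w : seq (bool * bool)) : R :=
  if w is (l, a) :: w' then
    bernoulli_pmf p l * bernoulli_pmf (mu h (x, l)) a
    * word_prob p mu (rcons h ((x, l), a)) (next_age (x, l) a) w'
  else 1.

Lemma word_prob_ge0 (R : realType) (p : R) (mu : policy R) h x w :
  0 <= p <= 1 -> 0 <= word_prob p mu h x w.
Proof.
move=> p01; elim: w h x => [|[l a] w IHw] h x //=.
by rewrite !mulr_ge0 // bernoulli_pmf_ge0 ?update_prob01.
Qed.

Lemma sum_word_prob (R : realType) (p : R) (mu : policy R) n h x :
  \sum_(w : n.-tuple (bool * bool)) word_prob p mu h x w = 1.
Proof.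
elim: n h x => [|n IHn] h x.
  by rewrite (big_pred1 [tuple]) => [|w] //; apply/esym/eqP; rewrite [LHS]tuple0.
rewrite (reindex (fun u : (bool * bool) * n.-tuple (bool * bool) =>
  [tuple of u.1 :: u.2])) /=; last first.
  exists (fun w : n.+1.-tuple (bool * bool) => (thead w, [tuple of behead w])).
    by move=> [b w] _ /=; congr pair; apply: val_inj.
  by move=> w _; rewrite [RHS]tuple_eta.
rewrite -(pair_bigA _ (fun b (w : n.-tuple (bool * bool)) =>
  word_prob p mu h x (b :: w))) /=.
transitivity (\sum_(b : bool * bool)
    bernoulli_pmf p b.1 * bernoulli_pmf (mu h (x, b.1)) b.2).
  by apply: eq_bigr => -[l a] _; rewrite /= -mulr_sumr IHn mulr1.
rewrite -(pair_bigA _ (fun l a =>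
  bernoulli_pmf p l * bernoulli_pmf (mu h (x, l)) a)) /=.
by rewrite !big_bool /= -!mulrDr /bernoulli_pmf !subrKC !mulr1 subrKC.
Qed.

(* E_mu[C(S(0), A(0)) + ... + C(S(T), A(T))] when X(0) = x0. *)
Definition expected_cost (R : realType) (p c : R) (mu : policy R)
    (x0 T : nat) : R :=
  \sum_(w : T.+1.-tuple (bool * bool))
    word_prob p mu [::] x0 w *
    \sum_(sa <- trajectory x0 w) cost c sa.1 sa.2.

Definition average_cost (R : realType) (p c : R) (mu : policy R)
    (x0 : nat) : \bar R :=
  limn_esup (fun T : nat => ((T.+1)%:R^-1 * expected_cost p c mu x0 T)%:E).

(* One and the same policy has to be optimal for every initial age. *)
Definition Omega_optimal (R : realType) (p c : R) (mu : policy R) : Prop :=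
  forall x0 : nat, (0 < x0)%N ->
  forall mu' : policy R,
    (average_cost p c mu x0 <= average_cost p c mu' x0)%E.

(* Main.v *)
(* Let [V] solve the average-cost optimality equation with gain [g].  The
   threshold policy attains the minimum in it and [V] is bounded below, so its
   expected cost over [n] slots is at most [g n + O(1)].  For any other policy,
   [e n + E V(X(n)) >= g n + V(x0)], where [e n] is the expected cost over [n]
   slots, but [V] is unbounded and [E V(X(n))] could a priori be of order [n].
   Since [V] grows at most linearly and the cost of a slot dominates the next
   age, [E V(X(n + 1)) <= A (e (n + 1) - e n) + B], so the deficit [g n - e n]
   satisfies a contractive recurrence and stays bounded.  The optimality
   equation is solved explicitly, with [V] quadratic below the threshold and
   linear above it. *)
Require Import Defs.
From mathcomp Require Import all_boot all_order all_algebra.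
From mathcomp Require Import all_classical all_reals all_analysis.
From mathcomp Require Import ring lra.

Set Implicit Arguments.
Unset Strict Implicit.
Unset Printing Implicit Defensive.

Import Order.TTheory GRing.Theory Num.Theory numFieldNormedType.Exports.
Local Open Scope ring_scope.
Local Open Scope classical_set_scope.

(** * Limits superior of averages *)

Lemma le_limn_esup (R : realType) (u v : (\bar R)^nat) :
  (forall n, u n <= v n)%E -> (limn_esup u <= limn_esup v)%E.
Proof.
move=> uv; rewrite !limn_esup_lim.
apply: lee_lim; [exact: is_cvg_esups|exact: is_cvg_esups|].
apply: nearW => n; apply: ge_ereal_sup => _ [k /= nk <-].
by apply: (le_trans (uv k)); apply: ereal_sup_ubound; exists k.
Qed.

(** The constant contributes [M / (T + 1)], which vanishes: total costs matter only up to a bounded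
    error. *)
Lemma limn_esup_affine_mean (R : realType) (g M : R) :
  limn_esup (fun T : nat => (T.+1%:R^-1 * (g *+ T.+1 + M))%:E) = g%:E.
Proof.
suff /cvg_limn_einf_sup[_ ->] :
  (fun T : nat => (T.+1%:R^-1 * (g *+ T.+1 + M))%:E) @ \oo --> g%:E by [].
have -> : (fun T : nat => (T.+1%:R^-1 * (g *+ T.+1 + M))%:E) =
    (fun T : nat => (g + @harmonic R T * M)%:E).
  apply/funext => T /=; congr EFin.
  by rewrite mulrDr -[g *+ _]mulr_natl mulKf // pnatr_eq0.
apply: cvg_EFin; first exact: nearW.
rewrite -[X in _ --> X]addr0 -[X in _ + X](mul0r M).
apply: cvgD; first exact: cvg_cst.
by apply: cvgM; [exact: cvg_harmonic|exact: cvg_cst].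
Qed.

(** * Expected cost as a recursion over slots *)

(** Expectation over one slot, written out as a polynomial so that [ring] proves the affine
    identities below. *)
Definition one_step (R : realType) (p : R) (d : bool -> R)
    (k : bool -> bool -> R) : R :=
  p * (d true * k true true + (1 - d true) * k true false) +
  (1 - p) * (d false * k false true + (1 - d false) * k false false).

Lemma one_stepE (R : realType) (p : R) (d : bool -> R)
    (k : bool -> bool -> R) :
  one_step p d k = \sum_(b : bool * bool)
    bernoulli_pmf p b.1 * bernoulli_pmf (d b.1) b.2 * k b.1 b.2.
Proof.
rewrite -(pair_bigA _ (fun l a =>
  bernoulli_pmf p l * bernoulli_pmf (d l) a * k l a)) /=.
by rewrite !big_bool /= /bernoulli_pmf /one_step -!mulrA -!mulrDr.
Qed.

Lemma le_one_step (R : realType) (p : R) (d : bool -> R)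
  (k k' : bool -> bool -> R) :
  0 <= p <= 1 -> (forall l, 0 <= d l <= 1) ->
  (forall l a, k l a <= k' l a) -> one_step p d k <= one_step p d k'.
Proof.
move=> /andP[p0 p1] d01 kk'; have /andP[t0 t1] := d01 true.
have /andP[f0 f1] := d01 false.
by rewrite /one_step; do !apply: lerD || apply: ler_wpM2l; rewrite ?subr_ge0.
Qed.

(** For each [l], a randomized action averages the two values [k l], so it costs at least the
    smaller one. *)
Lemma min_le_one_step (R : realType) (p v : R) (d : bool -> R)
  (k : bool -> bool -> R) :
  0 <= p <= 1 -> (forall l, 0 <= d l <= 1) ->
  (forall a b, v <= p * k true a + (1 - p) * k false b) ->
  v <= one_step p d k.
Proof.
move=> p01 d01 vk; pose a l := k l true < k l false.
apply: (le_trans (vk (a true) (a false))).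
rewrite [leLHS](_ : _ = one_step p d (fun l _ => k l (a l))).
  by apply: le_one_step => // l b; rewrite /a; case: ltP; case: b => // /ltW.
by rewrite /one_step; ring.
Qed.

(* Expected cost of [n] slots plus a terminal cost [f] of the final age. *)
Fixpoint horizon_cost (R : realType) (p c : R) (mu : policy R)
    (h : seq (state * bool)) (x n : nat) (f : nat -> R) : R :=
  if n is n'.+1 then
    one_step p (fun l => mu h (x, l)) (fun l a => cost c (x, l) a +
      horizon_cost p c mu (rcons h ((x, l), a)) (next_age (x, l) a) n' f)
  else f x.

(** Conditioning on the first letter of the word gives the recursion of [horizon_cost]. *)
Lemma sum_word_prob_cost (R : realType) (p c : R) (mu : policy R) h x n :
  \sum_(w : n.-tuple (bool * bool)) word_prob p mu h x w *
    \sum_(sa <- trajectory x w) cost c sa.1 sa.2 =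
  horizon_cost p c mu h x n (fun=> 0).
Proof.
elim: n h x => [|n IHn] h x.
  rewrite (big_pred1 [tuple]) => [|w] /=; first by rewrite big_nil mulr0.
  by apply/esym/eqP; rewrite [LHS]tuple0.
rewrite (reindex (fun u : (bool * bool) * n.-tuple (bool * bool) =>
  [tuple of u.1 :: u.2])) /=; last first.
  exists (fun w : n.+1.-tuple (bool * bool) => (thead w, [tuple of behead w])).
    by move=> [b w] _ /=; congr pair; apply: val_inj.
  by move=> w _; rewrite [RHS]tuple_eta.
rewrite -(pair_bigA _ (fun b (w : n.-tuple (bool * bool)) =>
  word_prob p mu h x (b :: w) *
  \sum_(sa <- trajectory x (b :: w)) cost c sa.1 sa.2)) /=.
rewrite one_stepE; apply: eq_bigr => -[l a] _ /=; rewrite -IHn.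
under eq_bigr => w _ do rewrite big_cons /= -(mulrA (_ * _)).
rewrite -mulr_sumr; congr (_ * _); under eq_bigr => w _ do rewrite mulrDr.
by rewrite big_split /= -mulr_suml sum_word_prob mul1r.
Qed.

Lemma expected_costE (R : realType) (p c : R) (mu : policy R) x0 T :
  expected_cost p c mu x0 T = horizon_cost p c mu [::] x0 T.+1 (fun=> 0).
Proof. exact: sum_word_prob_cost. Qed.

(** * Average-cost bounds from solutions and subsolutions of the optimality equation *)

Section verification.
Context {R : realType}.
Variables (p c g : R) (V : nat -> R).
Hypotheses (p01 : 0 <= p <= 1) (c_ge0 : 0 <= c).

Definition action_value x l a := cost c (x, l) a + V (next_age (x, l) a).

Lemma cost_ge_next_age x l a : (next_age (x, l) a)%:R <= cost c (x, l) a.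
Proof.
rewrite /cost /next_age /=; case: a l => [] [] /=;
  rewrite ?(mulr1, mulr0, mulr0n, mulr1n, mul0r, subr0, addr0) -?(natr1 x);
  have := c_ge0; lra.
Qed.

Lemma horizon_cost_ge (mu : policy R) h x n :
  (forall x a b, g + V x <=
     p * action_value x true a + (1 - p) * action_value x false b) ->
  g *+ n + V x <= horizon_cost p c mu h x n V.
Proof.
move=> sub; elim: n h x => [|n IHn] h x /=; first by rewrite add0r.
rewrite mulrSr -addrA.
have mu01 l : 0 <= mu h (x, l) <= 1 by exact: update_prob01.
have := min_le_one_step p01 mu01 (sub x).
rewrite -(lerD2l (g *+ n)) => /le_trans; apply.
rewrite [leLHS](_ : _ = one_step p (fun l => mu h (x, l))
    (fun l a => g *+ n + action_value x l a)); last by rewrite /one_step; ring.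
by apply: le_one_step => // l a; rewrite addrCA lerD2l.
Qed.

(* The age after the last slot is at most the cost of that slot. *)
Lemma horizon_cost_terminal_le (mu : policy R) (A B : R) h x n :
  0 <= A -> (forall x, V x <= A * x%:R + B) ->
  horizon_cost p c mu h x n.+1 V <=
  (1 + A) * horizon_cost p c mu h x n.+1 (fun=> 0)
  - A * horizon_cost p c mu h x n (fun=> 0) + B.
Proof.
move=> A0 VAB; elim: n h x => [|n IHn] h x.
  rewrite /= mulr0 subr0.
  rewrite [leRHS](_ : _ = one_step p (fun l => mu h (x, l))
    (fun l a => (1 + A) * cost c (x, l) a + B)); last first.
    by rewrite /one_step; ring.
  apply: le_one_step => // [l|l a]; first exact: update_prob01.
  have := ler_wpM2l A0 (cost_ge_next_age x l a).
  have := VAB (next_age (x, l) a).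
  lra.
pose F m k l a := cost c (x, l) a +
  horizon_cost p c mu (rcons h ((x, l), a)) (next_age (x, l) a) m k.
have HS m k : horizon_cost p c mu h x m.+1 k =
  one_step p (fun l => mu h (x, l)) (F m k) by [].
rewrite !HS.
rewrite [leRHS](_ : _ = one_step p (fun l => mu h (x, l)) (fun l a =>
  (1 + A) * F n.+1 (fun=> 0) l a - A * F n (fun=> 0) l a + B)); last first.
  by rewrite /one_step; ring.
apply: le_one_step => // [l|l a]; first exact: update_prob01.
rewrite /F; have := IHn (rcons h ((x, l), a)) (next_age (x, l) a).
lra.
Qed.

Lemma average_cost_ge (mu : policy R) (A B : R) x0 :
  0 <= A -> (forall x, V x <= A * x%:R + B) ->
  (forall x a b, g + V x <=
     p * action_value x true a + (1 - p) * action_value x false b) ->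
  (g%:E <= average_cost p c mu x0)%E.
Proof.
move=> A0 VAB sub; pose e n := horizon_cost p c mu [::] x0 n (fun=> 0).
(* [M] is at least the fixed point of the affine contraction bounding the
   deficit [g *+ n - e n]. *)
pose M := Num.max 0 (A * g + B - V x0).
have M0 : 0 <= M by rewrite le_max lexx.
have MA : A * g + B - V x0 <= M by rewrite le_max lexx orbT.
have e_ge n : g *+ n - M <= e n.
  elim: n => [|n IHn]; first by rewrite /e /=; lra.
  have := le_trans (horizon_cost_ge mu [::] x0 n.+1 sub)
    (horizon_cost_terminal_le mu [::] x0 n A0 VAB).
  rewrite -/(e _) -/(e n) mulrSr => He.
  have A1 : 0 < 1 + A by lra.
  (* By [He] and the induction hypothesis, the deficit at [n + 1] times [1 + A] is at most
     [A * M + (A * g + B - V x0)], hence at most [(1 + A) * M]. *)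
  rewrite -(ler_pM2l A1); have := ler_wpM2l A0 IHn; lra.
rewrite -(limn_esup_affine_mean g (- M)) /average_cost.
apply: le_limn_esup => T; rewrite lee_fin expected_costE.
by apply: ler_wpM2l; rewrite ?invr_ge0.
Qed.

(** With terminal cost [V] the expected cost is exactly [g *+ n + V x]; replacing this terminal cost
    by 0 adds at most [K]. *)
Lemma average_cost_le (mu : policy R) (f : state -> bool) (K : R) x0 :
  deterministic_stationary mu f -> (forall x, - K <= V x) ->
  (forall x, g + V x = p * action_value x true (f (x, true)) +
                       (1 - p) * action_value x false (f (x, false))) ->
  (average_cost p c mu x0 <= g%:E)%E.
Proof.
move=> muf VK sol.
have solE n h x : horizon_cost p c mu h x n V = g *+ n + V x.
  elim: n h x => [|n IHn] h x /=; first by rewrite add0r.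
  rewrite /one_step !IHn !muf mulrSr -[RHS]addrA sol /action_value.
  by case: (f _); case: (f _) => /=; ring.
have terminal n h x :
    horizon_cost p c mu h x n (fun=> 0) - K <= horizon_cost p c mu h x n V.
  elim: n h x => [|n IHn] h x /=; first by rewrite add0r.
  rewrite [leLHS](_ : _ = one_step p (fun l => mu h (x, l)) (fun l a =>
    cost c (x, l) a + (horizon_cost p c mu (rcons h ((x, l), a))
      (next_age (x, l) a) n (fun=> 0) - K))); last by rewrite /one_step; ring.
  apply: le_one_step => // [l|l a]; first exact: update_prob01.
  by rewrite lerD2l.
rewrite -(limn_esup_affine_mean g (V x0 + K)) /average_cost.
apply: le_limn_esup => T; rewrite lee_fin expected_costE.
by apply: ler_wpM2l; rewrite ?invr_ge0 // addrA -(solE _ [::]) -lerBlDr.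
Qed.

End verification.

(** * Threshold policies and the explicit solution of the optimality equation *)

Lemma threshold01 (R : realType) (N : nat) (s : state) :
  0 <= ((s.2 && (N <= s.1)%N)%:R : R) <= 1.
Proof. by rewrite ler0n lern1 leq_b1. Qed.

Definition threshold_policy (R : realType) (N : nat) : policy R :=
  @Policy R (fun _ s => (s.2 && (N <= s.1)%N)%:R)
    (fun _ s => threshold01 R N s).

Lemma threshold_policyP (R : realType) (N : nat) :
  (0 < N)%N -> threshold_type (threshold_policy R N).
Proof.
by move=> N0; exists (fun s => s.2 && (N <= s.1)%N); split => //; exists N.
Qed.

(** [N] is the least positive integer with [c <= T N]; the last bound is [T (N - 1) <= c]. *)
Lemma optimal_threshold (R : realType) (al c : R) : 0 <= al -> 0 <= c ->
  exists N : nat, [/\ (0 < N)%N, c <= N%:R * (N%:R + 1) / 2 + al * N%:R &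
    N%:R * (N%:R - 1) / 2 + al * (N%:R - 1) <= c].
Proof.
move=> al0 c0; pose T N : R := N%:R * (N%:R + 1) / 2 + al * N%:R.
have T_unbounded : exists N, c <= T N.
  exists (Num.bound c).+1; have := archi_boundP c0.
  rewrite /T -natr1; set b := (_%:R); have b0 : 0 <= b by rewrite ler0n.
  have := mulr_ge0 al0 b0; nra.
case: (ex_minnP T_unbounded) => -[|N] TN minN.
  (* Here [c <= T 0 = 0], so [c = 0] and the threshold 1 satisfies both bounds. *)
  exists 1%N; split=> //; move: TN; rewrite /T; lra.
exists N.+1; split=> //.
have : ~~ (c <= T N) by apply/negP => /minN; rewrite ltnn.
by rewrite -ltNge /T -natr1 => /ltW; lra.
Qed.

(** Compares idling below the threshold with a successful update. The gap is an explicit sum of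
    nonnegative terms in [d = n - x - 1], namely the one in [s1]. *)
Lemma idle_value_le (R : realType) (al ga n x : R) :
  0 <= al -> n <= ga -> x + 1 <= n ->
  ga + al + (al * n + (n * (n + 1) - x * (x + 1)) / 2 - (n - x) * (ga + al)) <=
  ga * (1 + al).
Proof.
move=> al0 nga xn; pose d := n - x - 1.
have d0 : 0 <= d by rewrite /d; lra.
have dd := mulr_ge0 d0 d0; have dal := mulr_ge0 d0 al0.
have s0 : 0 <= (d + 1 + al) * (ga - n) by rewrite mulr_ge0; lra.
have s1 : 0 <= (d + 1 + al) * (ga - n) + d * al + d * d / 2 + d / 2.
  by do ![apply: addr_ge0 => //]; lra.
rewrite -subr_ge0; apply: (le_trans s1).
by rewrite /d le_eqVlt; apply/orP; left; apply/eqP; field.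
Qed.

Lemma bellman_solution (R : realType) (p c : R) : 0 < p <= 1 -> 0 <= c ->
  exists (N : nat) (g A B K : R) (V : nat -> R),
  [/\ (0 < N)%N, 0 <= A, forall x, - K <= V x <= A * x%:R + B,
    forall x a b, g + V x <= p * action_value c V x true a +
                             (1 - p) * action_value c V x false b &
    forall x, g + V x = p * action_value c V x true (N <= x)%N +
                        (1 - p) * action_value c V x false false].
Proof.
(* [al] is the mean number of slots without arrival before the next arrival. *)
move=> /andP[p0 p1] c0; pose al := p^-1 - 1.
have pal : p * (1 + al) = 1 by rewrite /al addrC subrK mulfV ?gt_eqF.
have al0 : 0 <= al by rewrite subr_ge0 invf_ge1.
have qE : 1 - p = p * al by lra.
have [N [N0 cN Nc]] := optimal_threshold al0 c0.
have n1 : 1 <= N%:R :> R by rewrite ler1n.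
set n : R := N%:R in cN Nc n1.
have nal : 0 < n + al by lra.
(* The gain of the threshold-[n] policy is [ga + al].  Updating is
   optimal from age [n] on iff [ga <= n + 1], and idling before iff [n <= ga]
   (or [n = 1]); these are the two bounds on [c] that define [n]. *)
pose ga := (n * (n + 1) / 2 + al + c) / (n + al).
have gaE : ga * (n + al) = n * (n + 1) / 2 + al + c.
  by rewrite /ga mulfVK ?gt_eqF.
have ga_ge : n <= ga by rewrite ler_pdivlMr //; nra.
have ga_le : ga <= n + 1 by rewrite ler_pdivrMr //; nra.
pose g := ga + al.
(* Idling below [N] forces [V (x + 1) = V x + g - (x + 1)]; [W] solves this with [W n = al * n],
   matching the linear branch. The slope [al] solves [s = (1 - p) * (1 + s)]. *)
pose W (x : R) := al * n + (n * (n + 1) - x * (x + 1)) / 2 - (n - x) * g.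
pose V x := if (N <= x)%N then al * x%:R else W x%:R.
have WV x : (x <= N)%N -> V x = W x%:R.
  rewrite /V leq_eqVlt => /orP[/eqP ->|]; last by rewrite ltnNge => /negbTE ->.
  by rewrite leqnn /W; ring.
(* The value of a successful update, the same at every age; the equation [gaE] enters here. *)
have V1 : 1 + c + V 1%N = ga * (1 + al).
  by rewrite WV // /W /g; lra.
have idleE x : x%:R + 1 + V x.+1 =
    (if (N <= x)%N then (1 + al) * (x%:R + 1) else g + V x).
  have [Nx|xN] := leqP N x.
    by rewrite /V (leq_trans Nx) // -natr1; ring.
  by rewrite (WV x.+1) // (WV x (ltnW xN)) -natr1 /W; field.
have g0 : 0 <= g by rewrite /g; lra.
have aln : 0 <= al * n by rewrite mulr_ge0 //; lra.
have Vge x : - (n * g) <= V x.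
  have x0 := ler0n R x; rewrite /V; have [_|xN] := leqP N x.
    have ng : 0 <= n * g by rewrite mulr_ge0 // ler0n.
    by have := mulr_ge0 al0 x0; lra.
  have xn : x%:R <= n by rewrite ler_nat ltnW.
  have : 0 <= (n - x%:R) * (n + x%:R + 1) by rewrite mulr_ge0; lra.
  by rewrite /W; have := mulr_ge0 x0 g0; lra.
have Vle x : V x <= al * x%:R + (al * n + n * (n + 1) / 2).
  have x0 := ler0n R x; have alx := mulr_ge0 al0 x0.
  rewrite /V; have [_|xN] := leqP N x.
    have : 0 <= n * (n + 1) by rewrite mulr_ge0; lra.
    by lra.
  have xn : 0 <= n - x%:R by rewrite subr_ge0 ler_nat ltnW.
  have : 0 <= x%:R * (x%:R + 1) :> R by rewrite mulr_ge0; lra.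
  by rewrite /W; have := mulr_ge0 xn g0; lra.
(* At an arrival, the threshold rule picks an action of least value. *)
have better x : if (N <= x)%N then ga * (1 + al) <= x%:R + 1 + V x.+1
    else x%:R + 1 + V x.+1 <= ga * (1 + al).
  rewrite idleE; have [Nx|xN] := leqP N x.
    rewrite mulrC ler_wpM2l //; first by lra.
    by rewrite (le_trans ga_le) // lerD2r ler_nat.
  rewrite (WV x (ltnW xN)) /W /g; apply: idle_value_le => //.
  by rewrite natr1 ler_nat.
have action_valueE x l a : action_value c V x l a =
    if a then (if l then ga * (1 + al) else x%:R + 1 + V x.+1 + c)
    else x%:R + 1 + V x.+1.
  rewrite -V1 /action_value /cost /next_age.
  by case: a l => [] [] /=; ring.
have sol x : g + V x = p * action_value c V x true (N <= x)%N +
                        (1 - p) * action_value c V x false false.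
  rewrite !action_valueE idleE qE; have [Nx|xN] := leqP N x.
    rewrite /V Nx; apply/esym.
    transitivity (p * (1 + al) * (ga + al * (x%:R + 1))); first by ring.
    by rewrite pal /g; ring.
  by transitivity (p * (1 + al) * (g + V x)); [rewrite pal mul1r|ring].
exists N, g, al, (al * n + n * (n + 1) / 2), (n * g), V; split=> //.
  by move=> x; rewrite Vge Vle.
move=> x a b; rewrite sol.
apply: lerD; apply: ler_wpM2l; rewrite ?subr_ge0 ?(ltW p0) //.
  rewrite !action_valueE; have := better x.
  by case: ifP => _; case: a => // /ltW.
by rewrite !action_valueE; case: b => //; rewrite lerDl.
Qed.

Theorem theorem14 (R : realType) (p c : R) (hp : 0 <= p <= 1) (hc : 0 <= c) :
  exists mu : policy R, threshold_type mu /\ Omega_optimal p c mu.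
Proof.
have /andP[p_ge0 p_le1] := hp.
have [p0|p0] := eqVneq p 0.
  exists (threshold_policy R 1); split; first exact: threshold_policyP.
  move=> x0 _ mu'.
  (* Without arrivals the linear functions [x |-> g x] are subsolutions for
     every [g], so that every policy has an infinite average cost. *)
  suff -> : average_cost p c mu' x0 = +oo%E by rewrite leey.
  apply/eqyP => g g0.
  apply: (@average_cost_ge R p c g (fun x => g * x%:R) hp hc mu' g 0 x0
    (ltW g0)).
    by move=> x; rewrite addr0.
  move=> x a b; rewrite p0 mul0r add0r subr0 mul1r /action_value /cost /next_age.
  rewrite andbF /= mulr0 subr0 -natr1.
  have := ler0n R x; have : 0 <= c * b%:R by rewrite mulr_ge0.
  lra.
have p_gt0 : 0 < p <= 1 by rewrite lt_neqAle eq_sym p0 p_ge0.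
have [N [g [A [B [K [V [N0 A0 VAB sub sol]]]]]]] := bellman_solution p_gt0 hc.
exists (threshold_policy R N); split; first exact: threshold_policyP.
move=> x0 _ mu'; apply: (@le_trans _ _ g%:E).
  apply: (@average_cost_le R p c g V hp _ (fun s => s.2 && (N <= s.1)%N) K) => //.
  by move=> x; case/andP: (VAB x).
apply: (@average_cost_ge R p c g V hp hc mu' A B) => //.
by move=> x; case/andP: (VAB x).
Qed.
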